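(* For any $h\ge 1$, the generating function $$f_h(x,y)=\sum_{W\in W_{(0,h-1)}(\mathcal G_h)}x^{|W|}y^{\|W\|}$$ that counts growing self-avoiding walks on $\mathcal G_h$ that start in the top-left corner $(0,h-1)$ by length and displacement is rational.
   Context: $\mathcal G_h$ is the half-infinite grid graph with vertex set $\mathbb N\times\{0,\dots,h-1\}$ ($0\in\mathbb N$), with an edge between two points exactly when they are at Euclidean distance $1$. A growing self-avoiding walk (GSAW) on a graph is a finite directed walk that visits no vertex twice and whose final vertex is trapped, i.e. all of its neighbors are visited by the walk. $W_v(G)$ denotes the set of GSAWs on $G$ starting at the vertex $v$. $|W|$ is the length of $W$ (number of edges) and $\|W\|$ is its displacement (difference between the largest and smallest $x$-coordinates of its vertices). ''Rational'' means that the formal power series equals a quotient of two polynomials. *)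

(* Defs.v *)
From HB Require Import structures.
From mathcomp Require Import all_boot all_order all_algebra.
From mathcomp Require Import finmap boolp classical_sets functions cardinality.

Set Implicit Arguments.
Unset Strict Implicit.
Unset Printing Implicit Defensive.

Import GRing.Theory.
Local Open Scope ring_scope.
Local Open Scope classical_set_scope.

(* The vertex (x, y) of the half-infinite grid of height [h]. *)
Notation grid_vertex h := (nat * 'I_h)%type.

(* Adjacency at Euclidean distance 1, stated as squared distance 1. *)
Definition grid_edge (h : nat) : rel (grid_vertex h) := fun u w =>
  (u.1%:Z - w.1%:Z) ^+ 2 + ((u.2 : nat)%:Z - (w.2 : nat)%:Z) ^+ 2 == 1.

Definition top_left (h : nat) (h_gt0 : (1 <= h)%N) : grid_vertex h :=
  (0%N, Ordinal (etrans (ltn_predL h) h_gt0)).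

(* As in [path], a walk starting at [v] is represented by the sequence [p] of
   its subsequent vertices: its vertex sequence is [v :: p] and its length
   (number of edges) is [size p]. *)
Definition gsaw (V : eqType) (e : rel V) (v : V) : set (seq V) :=
  [set p | [/\ path e v p, uniq (v :: p) &
               forall w, e (last v p) w -> w \in v :: p]].

Definition displacement (h : nat) (v : grid_vertex h)
    (p : seq (grid_vertex h)) : nat :=
  (\max_(u <- v :: p) u.1 - \big[minn/v.1]_(u <- v :: p) u.1)%N.

(* The walks contributing to the monomial x^n y^m. *)
Definition gsaw_class (h : nat) (v : grid_vertex h) (n m : nat) :
    set (seq (grid_vertex h)) :=
  [set p | [/\ gsaw (@grid_edge h) v p, size p = n & displacement v p = m]].

(* Formal power series in x, y: [f i j] is the coefficient of x^i y^j. *)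
Definition fps2 (R : Type) := nat -> nat -> R.

Definition fps2_mul (R : pzRingType) (f g : fps2 R) : fps2 R := fun i j =>
  \sum_(k < i.+1) \sum_(l < j.+1) f k l * g (i - k)%N (j - l)%N.

(* In [{poly {poly R}}] the outer variable is x and the inner one is y. *)
Definition fps2_of_poly (R : nzRingType) (P : {poly {poly R}}) : fps2 R :=
  fun i j => P`_i`_j.

(* f = P / Q, that is Q f = P with Q nonzero. *)
Definition fps2_rational (R : fieldType) (f : fps2 R) : Prop :=
  exists P Q : {poly {poly R}},
    Q != 0 /\ fps2_mul (fps2_of_poly Q) f =2 fps2_of_poly P.

(* [fset_set] is the empty set on infinite sets; [finite_gsaw_class] below
   shows that this case does not occur. *)
Definition gsaw_gf (h : nat) (v : grid_vertex h) : fps2 rat := fun n m =>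
  #|` fset_set (gsaw_class v n m)|%:R.

Lemma grid_edge_bound (h : nat) (u w : grid_vertex h) :
  grid_edge u w -> (w.1 <= u.1.+1)%N.
Proof.
case: u w => [a b] [c d]; rewrite /grid_edge /= leqNgt => /eqP E.
apply/negP => lt; move: E.
rewrite -(subnKC (ltnW lt)) addSnnS PoszD opprD addrA subrr add0r sqrrN.
case k: (c - a.+1)%N => [|k']; first by move: lt; rewrite -subn_gt0 k.
by have := Num.Theory.sqr_ge0 ((b : nat)%:Z - (d : nat)%:Z); case: (_ ^+ 2).
Qed.

Lemma finite_gsaw_class (h : nat) (v : grid_vertex h) (n m : nat) :
  finite_set (gsaw_class v n m).
Proof.
pose N := (v.1 + n)%N.
pose g (t : n.-tuple ('I_N.+1 * 'I_h)) : seq (grid_vertex h) :=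
  [seq (nat_of_ord x.1, x.2) | x <- t].
apply: (@sub_finite_set _ _ (g @` setT)); last exact/finite_image/finite_finset.
move=> p [[pth _ _] sz _].
have bnd : forall u, u \in p -> (u.1 <= N)%N.
  rewrite /N -sz; elim: p v pth {sz g N} => //= w p IH v /andP[/grid_edge_bound le pth] u.
  rewrite inE => /predU1P[->|/(IH _ pth) leu].
    by rewrite addnS -addSn (leq_trans le) ?leq_addr.
  by rewrite (leq_trans leu) // addnS -addSn leq_add2r.
have szt : size [seq (inord u.1 : 'I_N.+1, u.2) | u <- p] == n by rewrite size_map sz.
exists (Tuple szt) => //; rewrite /g /= -map_comp -[RHS]map_id.
by apply/eq_in_map => -[a b] /bnd /= le; rewrite inordK.
Qed.

(* Main.v *)
Require Import Defs.
From mathcomp Require Import all_boot all_algebra.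
From mathcomp Require Import finmap boolp classical_sets cardinality zify.

(* A transfer-matrix argument over Q[x], one column at a time.  The restriction
   of a walk to the columns [0..k] forgets its excursions to the right of column
   [k]: its consecutive vertices are adjacent or both lie in column [k].  Passing
   from [0..k+1] to [0..k+2] inserts runs of vertices of column [k+2].  Keeping
   the order in which the vertices are visited makes this step local: since a
   step never jumps over a column, the longer walk is determined by the shorter
   one and by its subword on the columns [k..k+2], and these two can be any pair
   that agree on the columns [k, k+1], the subword satisfying a condition of its
   own.  So the number of extensions depends only on the subword on the last two
   columns, of which there are finitely many up to translation.  By
   Cayley-Hamilton the coefficients of y^m, as elements of Q[x], then satisfy a
   linear recurrence with constant coefficients. *)

Set Implicit Arguments.
Unset Strict Implicit.
Unset Printing Implicit Defensive.

Import GRing.Theory.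
Local Open Scope ring_scope.

(** * Linear recurrences and rationality *)

(** The reciprocal polynomial of [c] is the denominator: the recurrence kills all terms of the
    product of degree at least [d] in y. [swapXY] is needed because the recurrence runs in y, the
    inner variable. *)
Lemma fps2_rational_recurrence (R : fieldType) (F : nat -> {poly R})
    (c : {poly {poly R}}) :
  c != 0 -> (forall n, \sum_(k < size c) c`_k * F (n + k)%N = 0) ->
  fps2_rational (fun i j => (F j)`_i).
Proof.
move=> c_neq0; rewrite -(prednK (n := size c)) ?size_poly_gt0 //.
set d := (size c).-1 => cF.
pose q : {poly {poly R}} := \poly_(l < d.+1) c`_(d - l).
pose p : {poly {poly R}} := \poly_(j < d) \sum_(l < j.+1) q`_l * F (j - l)%N.
exists (swapXY p), (swapXY q); split.
  rewrite swapXY_eq0; apply: contraNneq c_neq0 => /(congr1 (fun r : {poly {poly R}} => r`_0)).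
  by rewrite coef_poly subn0 coef0 -lead_coefE => /eqP; rewrite lead_coef_eq0.
move=> i j; rewrite /fps2_mul /fps2_of_poly coef_swapXY.
transitivity ((\sum_(l < j.+1) q`_l * F (j - l)%N)`_i).
  rewrite exchange_big coef_sum; apply: eq_bigr => l _.
  by rewrite coefM; apply: eq_bigr => k _; rewrite coef_swapXY.
rewrite [p`_j]coef_poly; case: ltnP => // le_dj; apply: (congr1 (fun u : {poly R} => u`_i)).
rewrite -(big_mkord predT (fun l => q`_l * F (j - l)%N)).
rewrite (@big_cat_nat _ _ _ d.+1) //= ?ltnS // [X in _ + X]big_nat_cond.
rewrite [X in _ + X]big1 ?addr0; last first.
  by move=> l /andP[/andP[lt_dl _] _]; rewrite coef_poly ltnNge lt_dl mul0r.
rewrite -[RHS](cF (j - d)%N) big_mkord (reindex_inj rev_ord_inj) /=.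
apply: eq_bigr => k _; have le_kd : (k <= d)%N by rewrite -ltnS.
by rewrite coef_poly subSS ltnS leq_subr subKn //; congr (_ * F _); lia.
Qed.

(** Since [g (n + k)] is [g n *m M ^+ k], the sum is the characteristic polynomial evaluated at [M],
    between [g n] and [a]. *)
Lemma linear_system_recurrence (R : comNzRingType) (d : nat) (M : 'M[R]_d.+1)
    (g : nat -> 'rV[R]_d.+1) (a : 'cV[R]_d.+1) :
  (forall n, g n.+1 = g n *m M) ->
  forall n, \sum_(k < size (char_poly M)) (char_poly M)`_k * (g (n + k)%N *m a) 0 0 = 0.
Proof.
move=> gS n; have gD k : g (n + k)%N = g n *m M ^+ k.
  elim: k => [|k IH]; first by rewrite addn0 expr0 mulmx1.
  by rewrite addnS gS IH -mulmxA exprSr.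
transitivity ((g n *m horner_mx M (char_poly M) *m a) 0 0); last first.
  by rewrite Cayley_Hamilton mulmx0 mul0mx mxE.
rewrite -[X in horner_mx M X]coefK poly_def rmorph_sum mulmx_sumr mulmx_suml summxE.
apply: eq_bigr => k _; rewrite /= horner_mxZ rmorphXn /= horner_mx_X.
by rewrite gD -scalemxAr -scalemxAl [RHS]mxE.
Qed.

(** Grouping the weights of [G n] by state gives a row vector that each step multiplies by one
    constant matrix; the sum over accepted states is a linear functional of it. *)
Lemma transfer_recurrence (R : comNzRingType) (X S : eqType) (states : seq S)
    (G : nat -> seq X) (st : nat -> X -> S) (wt : X -> R) (M : S -> S -> R)
    (acc : pred S) (s0 : S) :
  s0 \in states -> uniq states ->
  (forall n p, p \in G n -> st n p \in states) ->
  (forall n t, t \in states ->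
     \sum_(p <- G n.+1 | st n.+1 p == t) wt p = \sum_(p <- G n) wt p * M (st n p) t) ->
  exists2 c : {poly R}, c != 0 & forall n,
    \sum_(k < size c) c`_k * (\sum_(p <- G (n + k)%N | acc (st (n + k)%N p)) wt p) = 0.
Proof.
move=> s0P states_uniq stP GS.
pose d := (size states).-1; have sz : d.+1 = size states.
  by rewrite prednK //; case: states s0P {d GS stP states_uniq}.
pose s (i : 'I_d.+1) := nth s0 states i.
have sP i : s i \in states by rewrite mem_nth // -sz.
pose g n : 'rV[R]_d.+1 := \row_i \sum_(p <- G n | st n p == s i) wt p.
have gsum n (f : S -> R) : \sum_(p <- G n) wt p * f (st n p) = \sum_i g n 0 i * f (s i).
  transitivity (\sum_(p <- G n) \sum_(i | st n p == s i) wt p * f (s i)).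
    rewrite big_seq [RHS]big_seq; apply: eq_bigr => p /stP stp.
    have [i0 i0E] : exists i0, s i0 = st n p.
      have lt : (index (st n p) states < d.+1)%N by rewrite sz index_mem.
      by exists (Ordinal lt); rewrite /s nth_index.
    rewrite -i0E (big_pred1 i0) // => i.
    by rewrite /s /= eq_sym nth_uniq -?sz.
  rewrite (exchange_big_dep predT) //=; apply: eq_bigr => i _.
  by rewrite mxE mulr_suml.
pose A : 'M[R]_d.+1 := \matrix_(i, j) M (s i) (s j).
have gS n : g n.+1 = g n *m A.
  apply/rowP => j; rewrite mxE GS // (gsum n (fun t => M t (s j))) mxE.
  by apply: eq_bigr => i _; rewrite [A _ _]mxE.
exists (char_poly A); first by rewrite monic_neq0 // char_poly_monic.
move=> n; rewrite -[RHS](linear_system_recurrence (\col_i (acc (s i))%:R) gS n).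
apply: eq_bigr => k _; congr (_ * _).
rewrite mxE big_mkcond /= (eq_bigr (fun p => wt p * (acc (st (n + k)%N p))%:R)).
  by rewrite (gsum _ (fun t => (acc t)%:R)); apply: eq_bigr => i _; rewrite !mxE.
by move=> p _; case: ifP; rewrite ?mulr1 ?mulr0.
Qed.

(** * Filtered paths and finite enumerations of words *)

Local Open Scope nat_scope.

(* [I] relates the last kept element to the current one. *)
Lemma path_filter_inv (T : Type) (Q D : pred T) (I r r' : rel T) :
  (forall y x b, D b -> I y x -> r x b ->
     if Q b then r' y b && I b b else I y b) ->
  forall s x y, all D s -> I y x -> path r x s ->
    path r' y (filter Q s) /\ I (last y (filter Q s)) (last x s).
Proof.
move=> step; elim=> //= b s IH x y /andP[Db Ds] Iyx /andP[rxb rs].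
have := step _ _ _ Db Iyx rxb; case: ifP => _ /=; last by move=> /(IH b y Ds); exact.
by move=> /andP[-> Ibb]; exact: IH Ibb rs.
Qed.

Fixpoint short_words (T : Type) (l : seq T) (n : nat) : seq (seq T) :=
  if n is n'.+1 then [::] :: [seq x :: w | x <- l, w <- short_words l n'] else [:: [::]].

Lemma mem_short_words (T : eqType) (l : seq T) (n : nat) (w : seq T) :
  (w \in short_words l n) = all [in l] w && (size w <= n).
Proof.
elim: n w => [|n IH] [|x w] //=; rewrite ?andbF // inE /=.
apply/allpairsP/idP => [[[y u] /= [ly]]|/andP[/andP[lx lw] szw]].
  by rewrite IH => /andP[lu szu] [-> ->]; rewrite ly lu.
by exists (x, w); rewrite /= IH lw.
Qed.

Definition cells (h m : nat) : seq (grid_vertex h) :=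
  [seq (i, r) | i <- iota 0 m, r <- enum 'I_h].

Lemma mem_cells (h m : nat) (u : grid_vertex h) : (u \in cells h m) = (u.1 < m).
Proof.
apply/allpairsP/idP => [[[i r] /= [+ _ ->]]|lt]; first by rewrite mem_iota.
by exists u; rewrite mem_iota mem_enum -surjective_pairing.
Qed.

(** The length bound loses nothing: a word without repetition is no longer than its alphabet. *)
Definition uniq_words (h m : nat) : seq (seq (grid_vertex h)) :=
  [seq w <- undup (short_words (cells h m) (size (cells h m))) | uniq w].

Lemma mem_uniq_words (h m : nat) (w : seq (grid_vertex h)) :
  (w \in uniq_words h m) = uniq w && all (fun u => u.1 < m) w.
Proof.
rewrite mem_filter mem_undup mem_short_words; case Uw: (uniq w) => //=.
rewrite (eq_all (@mem_cells h m)); case Aw: (all _ w) => //=.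
by apply: uniq_leq_size => // u /(allP Aw); rewrite mem_cells.
Qed.

Lemma uniq_uniq_words (h m : nat) : uniq (uniq_words h m).
Proof. by rewrite filter_uniq ?undup_uniq. Qed.

(** * Restricted walks, windows and translations *)

(** A jump inside column [k] is the trace of an excursion to the right, which leaves and re-enters
    through that column. *)
Definition frontier_edge (h k : nat) : rel (grid_vertex h) := fun u w =>
  grid_edge u w || (u.1 == k) && (w.1 == k).

(* The part of [frontier_edge] visible in the three columns [k-1, k, k+1]: an
   excursion outside of them starts and ends in the same outer column. *)
Definition window_edge (h k : nat) : rel (grid_vertex h) := fun u w =>
  grid_edge u w || (u.1 == w.1) && (u.1 != k).

Definition trapped (h : nat) (s : seq (grid_vertex h)) (u : grid_vertex h) : bool :=
  `[< forall w, grid_edge u w -> w \in s >].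

(* The restrictions to the columns [0..k] of the walks under study; if such a
   restriction ends in column [k], the walk may go on further right. *)
Definition partial_gsaw (h : nat) (v : grid_vertex h) (k : nat)
    (p : seq (grid_vertex h)) : bool :=
  [&& uniq (v :: p), all (fun u => u.1 <= k) p, path (@frontier_edge h k) v p &
      ((last v p).1 < k) ==> trapped (v :: p) (last v p)].

Definition shift (h k : nat) (u : grid_vertex h) : grid_vertex h := (u.1 - k, u.2).

Definition unshift (h k : nat) (u : grid_vertex h) : grid_vertex h := (u.1 + k, u.2).

(** Renumbering the columns from 0 makes the states for different [k] comparable. *)
Definition window (h k : nat) (p : seq (grid_vertex h)) : seq (grid_vertex h) :=
  [seq shift k u | u <- p & k <= u.1].

Definition upto (h k : nat) (p : seq (grid_vertex h)) : seq (grid_vertex h) :=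
  [seq u <- p | u.1 <= k].

(* [w] is the state of a walk on its last two columns, numbered 0 and 1, and [W]
   its subword after column 2 is added.  The walk enters the window from the
   left; the phantom vertex [(0, r)] before [W] excludes a start in column 2. *)
Definition extends (h : nat) (r : 'I_h) (w W : seq (grid_vertex h)) : bool :=
  [&& upto 1 W == w, path (@window_edge h 1) (0, r) W &
      ((last (0, r) W).1 == 1) ==> trapped W (last (0, r) W)].

Lemma grid_edge_sym (h : nat) : symmetric (@grid_edge h).
Proof.
by move=> u w; rewrite /grid_edge -sqrrN opprB -[X in (_ + X)%R]sqrrN opprB.
Qed.

Lemma grid_edge_cols (h : nat) (u w : grid_vertex h) :
  grid_edge u w -> u.1 <= w.1.+1 /\ w.1 <= u.1.+1.
Proof. by move=> uw; split; apply: grid_edge_bound; rewrite // grid_edge_sym. Qed.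

Lemma grid_edge_unshift (h k : nat) (u w : grid_vertex h) :
  grid_edge (unshift k u) (unshift k w) = grid_edge u w.
Proof. by rewrite /grid_edge /= !PoszD opprD addrACA subrr addr0. Qed.

Lemma window_edge_unshift (h k j : nat) (u w : grid_vertex h) :
  window_edge (j + k) (unshift k u) (unshift k w) = window_edge j u w.
Proof. by rewrite /window_edge grid_edge_unshift /= !eqn_add2r. Qed.

Lemma shiftK (h k : nat) : cancel (@unshift h k) (shift k).
Proof. by case=> a b; rewrite /shift /unshift /= addnK. Qed.

Lemma unshiftK (h k : nat) (u : grid_vertex h) : k <= u.1 -> unshift k (shift k u) = u.
Proof. by case: u => a b /= le; rewrite /shift /unshift /= subnK. Qed.

Lemma windowE (h k : nat) (p : seq (grid_vertex h)) :
  [seq u <- p | k <= u.1] = map (unshift k) (window k p).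
Proof.
rewrite /window; elim: p => //= u p IH.
by case: ifP => //= le; rewrite unshiftK //; congr (_ :: _).
Qed.

Lemma window_window (h k j : nat) (p : seq (grid_vertex h)) :
  window j (window k p) = window (k + j) p.
Proof.
elim: p => //= u p IH; rewrite /window /= in IH *.
case: (leqP k u.1) => [le|lt] /=.
  have ->: (j <= u.1 - k) = (k + j <= u.1) by lia.
  by case: ifP => _ //=; rewrite IH /shift /= subnDA.
by rewrite IH; case: ifP => //; lia.
Qed.

Lemma upto_window (h k j : nat) (p : seq (grid_vertex h)) :
  upto j (window k p) = window k (upto (j + k) p).
Proof.
rewrite /window /upto; elim: p => //= u p IH.
case: (leqP k u.1) => [le|lt] /=; last first.
  by rewrite IH; case: ifP => //= _; rewrite leqNgt lt.
have ->: (u.1 - k <= j) = (u.1 <= j + k) by lia.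
by case: ifP => _ //=; rewrite ?le /= IH.
Qed.

(* Both filters keep enough to rebuild the walk because a step cannot reach
   two columns at distance two. *)
Lemma restrictions_inj (h k : nat) (v : grid_vertex h) (p q : seq (grid_vertex h)) :
  path (@frontier_edge h k.+2) v p -> path (@frontier_edge h k.+2) v q ->
  upto k.+1 p = upto k.+1 q -> window k p = window k q -> p = q.
Proof.
rewrite /upto => pP qP up /(congr1 (map (unshift k))); rewrite -!windowE.
elim: p q v pP qP up => [|a p IH] [|b q] v //=.
- by move=> _ /andP[_ _]; case: ifP => // b1 _; case: ifP => //; lia.
- by move=> /andP[_ _] _; case: ifP => // b1 _; case: ifP => //; lia.
move=> /andP[va pP] /andP[vb qP] up win.
(* Both heads follow [v], so they cannot lie on opposite sides of the columns [k], [k.+1]; hence one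
   of the two filters keeps both and identifies them. *)
have ab_far : ~~ ((a.1 < k) && (k.+1 < b.1)) && ~~ ((b.1 < k) && (k.+1 < a.1)).
  by move: va vb => /orP[/grid_edge_cols|] + /orP[/grid_edge_cols|]; lia.
have eq_ab : a = b.
  case: (leqP a.1 k.+1) up => [ak|ak]; case: (leqP b.1 k.+1) => [bk|bk] up; first by case: up.
  1,2,3: have [ka kb] : k <= a.1 /\ k <= b.1 by clear -ak bk ab_far; lia.
  1,2,3: by move: win; rewrite ka kb => -[].
subst b; congr (_ :: _); apply: (IH q a) => //.
  by move: up; case: ifP => // _ [].
by move: win; case: ifP => // _ [].
Qed.

(** * Cutting walks into subwords and gluing them back *)

(** Invariant: the last kept vertex is the current one, or the walk is in column [k.+2] and the last
    kept vertex is in column [k.+1], the only gate to it. *)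
Lemma path_upto (h k : nat) (v : grid_vertex h) (p : seq (grid_vertex h)) :
  v.1 <= k.+1 -> all (fun u => u.1 <= k.+2) p ->
  path (@frontier_edge h k.+2) v p ->
  path (@frontier_edge h k.+1) v (upto k.+1 p) /\
    ((last v p).1 != k.+2 -> last v (upto k.+1 p) = last v p) /\
    ((last v (upto k.+1 p)).1 != k.+1 -> last v (upto k.+1 p) = last v p).
Proof.
move=> vk pk vp; suff [-> /orP I] : path (@frontier_edge h k.+1) v (upto k.+1 p) /\
    ((last v (upto k.+1 p) == last v p) && ((last v (upto k.+1 p)).1 <= k.+1) ||
     ((last v p).1 == k.+2) && ((last v (upto k.+1 p)).1 == k.+1)).
  by case: I => /andP[/eqP-> le]; rewrite ?eqxx ?le.
apply: (path_filter_inv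
  (I := fun y x => (y == x) && (y.1 <= k.+1) || (x.1 == k.+2) && (y.1 == k.+1)) _ pk _ vp);
  last by rewrite eqxx vk.
move=> y x b /= bk Iyx /orP rxb; rewrite eqxx /frontier_edge.
case/orP: Iyx => [/andP[/eqP-> {y} xk]|/andP[/eqP xk /eqP yk]].
  case: rxb => [xb|]; last by move: xk => /[swap] /andP[/eqP-> _]; rewrite ltnn.
  have [c1 c2] := grid_edge_cols xb; rewrite xb; case: leqP => // bk2.
  have xk1 : k.+1 <= x.1 by rewrite -ltnS (leq_trans bk2 c2).
  by rewrite !eqn_leq bk bk2 xk xk1 orbT.
have bk1 : k.+1 <= b.1.
  by case: rxb => [/grid_edge_cols[+ _]|/andP[_ /eqP->]]; rewrite ?xk.
case: leqP => bk2; rewrite yk eqxx /= ?andbT; apply/orP; right.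
  by rewrite eqn_leq bk1 bk2.
by rewrite eqn_leq bk bk2.
Qed.

(** Mirror image of [path_upto], with column [k] as the gate to the part on its left; [y] stands for
    the start, which is discarded. *)
Lemma path_from (h k : nat) (v y : grid_vertex h) (p : seq (grid_vertex h)) :
  v.1 < k -> y.1 = k ->
  path (@frontier_edge h k.+2) v p ->
  let w := [seq u <- p | k <= u.1] in
  path (@window_edge h k.+1) y w /\
    (k <= (last v p).1 -> last y w = last v p) /\
    ((last y w).1 != k -> last y w = last v p).
Proof.
move=> vk yk vp w; suff [-> /orP I] : path (@window_edge h k.+1) y w /\
    ((last y w == last v p) && (k <= (last y w).1) ||
     ((last v p).1 < k) && ((last y w).1 == k)).
  by case: I => [/andP[/eqP-> _]//|/andP[lt ->]]; split=> //; split=> //; rewrite leqNgt lt.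
apply: (path_filter_inv (D := predT)
  (I := fun y x => (y == x) && (k <= y.1) || (x.1 < k) && (y.1 == k)));
  [|exact: all_predT|by rewrite vk yk eqxx orbT|exact: vp].
move=> {w yk}y' x b _ Iyx /orP rxb; rewrite eqxx /window_edge.
case/orP: Iyx => [/andP[/eqP-> {y'} xk]|/andP[yk /eqP xk]].
  case: rxb => [xb|/andP[/eqP xk2 /eqP bk2]].
    have [c1 c2] := grid_edge_cols xb; rewrite xb; case: leqP => // bk2.
    by rewrite eqn_leq xk (leq_trans c1 bk2) orbT.
  by rewrite xk2 bk2 eqxx; case: leqP => //; clear; lia.
have bk : b.1 <= k.
  case: rxb => [/grid_edge_cols[_ xb]|/andP[/eqP E _]]; first exact: leq_trans xb yk.
  by move: yk; rewrite E; clear; lia.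
case: leqP => bk2; last by rewrite xk eqxx orbT.
rewrite (_ : b.1 = k) ?xk ?eqxx ?ltn_eqF ?orbT ?leqnn //; clear -bk bk2; lia.
Qed.

(* [x], [y], [z] are the last vertices already read in [p], read in [w], and
   output. No two letters of [p] and [w] compete for the next position: after a
   vertex of column [k], [w] cannot go on in column [k+2], and after a vertex of
   column [k+1], [p] cannot go on to the left of column [k]. *)
Lemma glue (h k : nat) (x y z : grid_vertex h) (p w : seq (grid_vertex h)) :
  [\/ [/\ x = z, y = z & k <= z.1 <= k.+1],
      [/\ x = z, y.1 = k & z.1 < k] |
      [/\ x.1 = k.+1, y = z & z.1 = k.+2]] ->
  path (@frontier_edge h k.+1) x p -> path (@window_edge h k.+1) y w ->
  all (fun u => u.1 <= k.+1) p -> all (fun u => k <= u.1 <= k.+2) w ->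
  [seq u <- p | k <= u.1] = upto k.+1 w ->
  exists q, [/\ path (@frontier_edge h k.+2) z q, upto k.+1 q = p &
                [seq u <- q | k <= u.1] = w].
Proof.
rewrite /upto; have [m] := ubnP (size p + size w).
elim: m p w x y z => // m IH p w x y z szm inv px pw allp allw pw_eq.
(* A head of [w] in column [k.+2] is invisible to [p] and is output at once. *)
have [[c [w' [Ew ck]]]|w_head] : (exists c w', w = c :: w' /\ c.1 = k.+2) \/
    (if w is c :: _ then c.1 <= k.+1 else true).
  case: w allw {szm pw pw_eq} => [|c w'] /=; first by right.
  case/andP=> /andP[_ ck] _; case: (leqP c.1 k.+1) => ck'; [by right|left].
  by exists c, w'; split=> //; apply/eqP; rewrite eqn_leq ck.
- have ck' : (c.1 <= k.+1) = false by rewrite ck ltnn.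
  have kc : k <= c.1 by rewrite ck; clear; lia.
  move: szm pw allw pw_eq; rewrite Ew /= addnS ltnS ck'.
  move=> szm /andP[yc pw] /andP[_ allw] pw_eq.
  have [zc xk] : frontier_edge k.+2 z c /\ x.1 = k.+1.
    case: inv => [[Ex Ey zk]|[_ yk _]|[-> Ey zk]];
      last by rewrite /frontier_edge zk ck eqxx orbT.
      subst x y; case/orP: yc => [zc|/andP[/eqP zk2 _]];
        last by move: zk; rewrite zk2 ck; clear; lia.
      by rewrite /frontier_edge zc; move: (grid_edge_cols zc) zk; rewrite ck; clear; lia.
    case/orP: yc => [/grid_edge_cols|/andP[/eqP + _]]; rewrite yk ck; clear; lia.
  have [|q [zq qp qw]] := IH p w' x c c szm _ px pw allp allw pw_eq; first by apply: Or33.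
  by exists (c :: q); rewrite /= zc ck' kc qp qw.
(* Likewise for a head of [p] to the left of column [k]. *)
have [[a [p' [Ep ak]]]|p_head] : (exists a p', p = a :: p' /\ a.1 < k) \/
    (if p is a :: _ then k <= a.1 else true).
  case: p {szm px pw_eq allp} => [|a p'] /=; first by right.
  by case: (leqP k a.1) => ak; [right|left; exists a, p'].
- have ak' : (k <= a.1) = false by rewrite leqNgt ak.
  have ka : a.1 <= k.+1 by apply: leq_trans (ltnW ak) _.
  move: szm px allp pw_eq; rewrite Ep /= addSn ltnS ak'.
  move=> szm /andP[xa px] /andP[_ allp] pw_eq.
  have {}xa : grid_edge x a by case/orP: xa => // /andP[_ /eqP E];
    move: ak; rewrite E; clear; lia.
  have [c1 c2] := grid_edge_cols xa.
  have [za yk] : frontier_edge k.+2 z a /\ y.1 = k.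
    rewrite /frontier_edge; case: inv => [[Ex Ey zk]|[Ex yk _]|[xk _ _]];
      last by clear -c1 xk ak; lia.
      by subst x y; rewrite xa; split=> //; clear -c1 ak zk; lia.
    by subst x; rewrite xa.
  have [|q [zq qp qw]] := IH p' w a y a szm _ px pw allp allw pw_eq; first by apply: Or32.
  by exists (a :: q); rewrite /= za ak' ka qp qw.
(* Both heads now lie in the shared columns, so [pw_eq] identifies them. *)
case: p szm px allp pw_eq p_head => [|b p'] szm px allp pw_eq p_head.
  case: w {szm pw allw} pw_eq w_head => [|c w'] /=; first by exists [::].
  by move=> + ck; rewrite ck.
case: w szm pw allw pw_eq w_head => [|c w'] /=; rewrite p_head //.
move=> szm /andP[yc pw] /andP[_ allw] + ck; rewrite ck => -[Ebc pw_eq]; subst c.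
move: px allp => /= /andP[xb px] /andP[_ allp].
(* From a shared column, [p] may jump only inside column [k.+1] and [w] only outside it, so a step
   allowed by both is a grid edge. *)
have zb : frontier_edge k.+2 z b.
  apply/orP; left; case: inv => [[Ex Ey zk]|[Ex yk zk]|[xk Ey zk]].
  - subst x y; case/orP: xb => // /andP[_ /eqP bk]; case/orP: yc => // /andP[/eqP E].
    by rewrite E bk eqxx.
  - by subst x; case/orP: xb => // /andP[/eqP E _]; move: zk; rewrite E; clear; lia.
  - by subst y; case/orP: yc => // /andP[/eqP E _]; move: ck; rewrite -E zk ltnn.
have [||q [zq qp qw]] := IH p' w' b b b _ _ px pw allp allw pw_eq; first by clear -szm; lia.
  by apply: Or31; rewrite p_head.
by exists (b :: q); rewrite /= zb ck p_head qp qw.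
Qed.

(** * Restriction and extension of partial walks *)

Lemma uniq_filter2 (T : eqType) (a b : pred T) (s : seq T) :
  (forall x, a x || b x) -> uniq (filter a s) -> uniq (filter b s) -> uniq s.
Proof.
move=> ab; elim: s => //= x s IH; case: ifP => ax; case: ifP => bx /=.
- by move=> /andP[xs us] /andP[_ us']; rewrite IH // andbT; move: xs; rewrite mem_filter ax.
- by move=> /andP[xs us] us'; rewrite IH // andbT; move: xs; rewrite mem_filter ax.
- by move=> us /andP[xs us']; rewrite IH // andbT; move: xs; rewrite mem_filter bx.
- by have := ab x; rewrite ax bx.
Qed.

Lemma shift_inj (h k : nat) (u w : grid_vertex h) :
  k <= u.1 -> k <= w.1 -> shift k u = shift k w -> u = w.
Proof. by move=> ku kw /(congr1 (unshift k)); rewrite !unshiftK. Qed.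

Lemma mem_window (h k : nat) (u : grid_vertex h) (p : seq (grid_vertex h)) :
  k <= u.1 -> (shift k u \in window k p) = (u \in p).
Proof.
move=> ku; apply/mapP/idP => [[w]|up]; last by exists u => //; rewrite mem_filter ku.
by rewrite mem_filter => /andP[kw wp] /(shift_inj ku kw) ->.
Qed.

Lemma uniq_window (h k : nat) (p : seq (grid_vertex h)) : uniq p -> uniq (window k p).
Proof.
move=> up; rewrite map_inj_in_uniq ?filter_uniq // => u w.
by rewrite !mem_filter => /andP[ku _] /andP[kw _]; exact: shift_inj.
Qed.

(** All neighbors of a vertex of column [k.+1] lie in columns from [k] on, where the window sees
    them. *)
Lemma trapped_window (h k : nat) (v u : grid_vertex h) (p : seq (grid_vertex h)) :
  v.1 < k -> u.1 = k.+1 -> trapped (v :: p) u = trapped (window k p) (shift k u).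
Proof.
move=> vk uk; have ku : k <= u.1 by rewrite uk.
apply/asboolP/asboolP => tr w.
  rewrite -(grid_edge_unshift k) unshiftK // => /tr.
  rewrite inE => /predU1P[E|wp]; last by rewrite -[w](shiftK k) mem_window //= leq_addl.
  by move: vk; rewrite -E /= ltnNge leq_addl.
move=> uw; have kw : k <= w.1 by have [] := grid_edge_cols uw; rewrite uk ltnS.
rewrite inE -(mem_window p kw); apply/orP; right; apply: tr.
by rewrite -(grid_edge_unshift k) !unshiftK.
Qed.

Lemma path_window (h k : nat) (r : 'I_h) (p : seq (grid_vertex h)) :
  path (@window_edge h 1) (0, r) (window k p) =
  path (@window_edge h k.+1) (k, r) [seq u <- p | k <= u.1].
Proof.
rewrite windowE (_ : (k, r) = unshift k (0, r)) // path_map.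
by apply: eq_path => u w; rewrite -[k.+1]add1n -(window_edge_unshift k).
Qed.

Lemma last_window (h k : nat) (r : 'I_h) (p : seq (grid_vertex h)) :
  last (k, r) [seq u <- p | k <= u.1] = unshift k (last (0, r) (window k p)).
Proof. by rewrite windowE (_ : (k, r) = unshift k (0, r)) // last_map. Qed.

Lemma trapped_sub (h : nat) (s t : seq (grid_vertex h)) (u : grid_vertex h) :
  {subset s <= t} -> trapped s u -> trapped t u.
Proof. by move=> st /asboolP tr; apply/asboolP => w /tr /st. Qed.

(** The trapping condition splits by the column of the last vertex: before [k.+1] it belongs to the
    restriction, in [k.+1] to the window, and in [k.+2] there is none. *)
Lemma partial_gsaw_restrict (h k : nat) (v : grid_vertex h) (q : seq (grid_vertex h)) :
  v.1 < k -> partial_gsaw v k.+2 q ->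
  partial_gsaw v k.+1 (upto k.+1 q) /\
  extends v.2 (window k (upto k.+1 q)) (window k q).
Proof.
move=> vk /and4P[/= /andP[vq uq] qk vqP qtr]; rewrite {1}/upto.
have vk1 : v.1 <= k.+1 by rewrite ltnW // ltnS ltnW.
have [pP [_ plast]] := path_upto vk1 qk vqP.
have [wP [_ wlast]] := path_from (y := (k, v.2)) vk erefl vqP.
split.
  apply/and4P; split=> //=.
  - by rewrite filter_uniq // mem_filter negb_and vq orbT.
  - exact: filter_all.
  apply/implyP => lt; move: (lt); rewrite plast ?ltn_eqF // => lt'.
  have /asboolP tr := implyP qtr (leqW lt').
  apply/asboolP => w lw; have := tr w lw; rewrite !inE mem_filter => /orP[->//|->].
  by have [_ /leq_trans->] := grid_edge_cols lw; rewrite ?orbT.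
apply/and3P; split; first by rewrite upto_window.
  by rewrite path_window.
apply/implyP => /eqP l1; have lk : (last (k, v.2) [seq u <- q | k <= u.1]).1 = k.+1.
  by rewrite last_window /= l1.
have lE := wlast; rewrite lk gtn_eqF // in lE; move/(_ isT): lE => lE.
have -> : last (0, v.2) (window k q) = shift k (last v q) by rewrite -lE last_window shiftK.
have lq : (last v q).1 = k.+1 by rewrite -lE.
by rewrite -(trapped_window q vk lq); apply: (implyP qtr); rewrite lq.
Qed.

Lemma partial_gsaw_extend (h k : nat) (v : grid_vertex h) (p w : seq (grid_vertex h)) :
  v.1 < k -> partial_gsaw v k.+1 p -> uniq w -> all (fun u => u.1 < 3) w ->
  extends v.2 (window k p) w ->
  exists q, [/\ partial_gsaw v k.+2 q, upto k.+1 q = p & window k q = w].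
Proof.
move=> vk /and4P[/= /andP[vp up] pk vpP ptr] uw w3 /and3P[/eqP pw wP wtr].
pose W := map (unshift k) w.
have Ew : window k W = w.
  rewrite /window /W; elim: w {uw w3 pw wP wtr W} => //= u w IH.
  by rewrite leq_addl /= shiftK IH.
have allW : all (fun u => k <= u.1 <= k.+2) W.
  rewrite all_map; apply: sub_all w3 => u /=; rewrite leq_addl ltnS => u2.
  by rewrite -add2n leq_add2r.
have WE : [seq u <- W | k <= u.1] = W.
  by apply/all_filterP; apply: sub_all allW => u /andP[].
have [|||q [vqP qp qW]] := @glue h k v (k, v.2) v p W _ vpP _ pk allW.
(* Gluing starts left of the window, with the phantom [(k, v.2)] as last vertex read in [W]. *)
- by apply: Or32.
- by rewrite -{1}WE -path_window Ew.
- rewrite windowE -pw -{1}Ew upto_window -windowE.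
  apply/all_filterP; rewrite all_filter; apply: sub_all allW => u /andP[ku _].
  by apply/implyP.
have qw : window k q = w by rewrite /window qW; exact: (mapK (@shiftK h k)).
have q_cases u : (u.1 <= k.+1) || (k <= u.1) by case: leqP => // /ltnW; exact: ltnW.
have qk : all (fun u => u.1 <= k.+2) q.
  apply/allP => u uq; case: (leqP u.1 k.+1) => [/leqW //|ku].
  have : u \in W by rewrite -qW mem_filter uq andbT ltnW // ltnW.
  by move/(allP allW)/andP => [].
have vk1 : v.1 <= k.+1 by rewrite ltnW // ltnS ltnW.
exists q; split=> //; apply/and4P; split=> //=.
  apply/andP; split; first by apply: contra vp => vq; rewrite -qp mem_filter vq andbT.
  apply: (@uniq_filter2 _ (fun u => u.1 <= k.+1) (fun u => k <= u.1)) => //.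
    by rewrite -/(upto k.+1 q) qp.
  by rewrite qW map_inj_uniq //; exact: can_inj (@shiftK h k).
apply/implyP => lt.
have [_ [plast _]] := path_upto vk1 qk vqP.
have [_ [wlast _]] := path_from (y := (k, v.2)) vk erefl vqP.
move: plast; rewrite ltn_eqF // qp => /(_ isT) plast.
case: (leqP (last v q).1 k) => lk.
  move: (implyP ptr); rewrite plast => /(_ lk); apply: trapped_sub => u.
  by rewrite !inE -qp mem_filter => /orP[->//|/andP[_ ->]]; rewrite orbT.
have lk1 : (last v q).1 = k.+1 by apply/eqP; rewrite eqn_leq lk -ltnS lt.
rewrite (trapped_window _ vk lk1) qw; move: (implyP wtr).
move: (wlast (ltnW lk)); rewrite last_window qw => <-; rewrite shiftK; apply.
by move: lk1; rewrite -(wlast (ltnW lk)) last_window qw /= -add1n => /addIn ->.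
Qed.

(** * Counting partial walks by state *)

Definition partial_gsaws (h : nat) (v : grid_vertex h) (k : nat) : seq (seq (grid_vertex h)) :=
  [seq p <- uniq_words h k.+1 | partial_gsaw v k p].

Lemma mem_partial_gsaws (h : nat) (v : grid_vertex h) (k : nat) (p : seq (grid_vertex h)) :
  (p \in partial_gsaws v k) = partial_gsaw v k p.
Proof.
rewrite mem_filter mem_uniq_words andb_idr //.
by case/and4P=> /= /andP[_ ->] pk _ _.
Qed.

Lemma uniq_partial_gsaws (h : nat) (v : grid_vertex h) (k : nat) :
  uniq (partial_gsaws v k).
Proof. by rewrite filter_uniq ?uniq_uniq_words. Qed.

Lemma window_uniq_words (h k j : nat) (p : seq (grid_vertex h)) :
  uniq p -> all (fun u => u.1 < k + j) p -> 0 < j -> window k p \in uniq_words h j.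
Proof.
move=> up pk j0; rewrite mem_uniq_words uniq_window //= all_map all_filter.
by apply: sub_all pk => u /= uk; apply/implyP => ku; rewrite ltn_subLR.
Qed.

(** An entry of the transfer matrix: the vertices added by an extension are those in column 2, and
    [window 1] forgets column 0 to give the next state. *)
Definition transfer (h : nat) (r : 'I_h) (s t : seq (grid_vertex h)) : {poly rat} :=
  (\sum_(w <- uniq_words h 3 | extends r s w && (window 1 w == t))
     'X^(count (fun u => u.1 == 2) w))%R.

(** [cut] is a bijection from the longer walks to the pairs of a shorter walk and an admissible
    window, and lengths add up along it. *)
Lemma partial_gsaws_transfer (h k : nat) (v : grid_vertex h) (t : seq (grid_vertex h)) :
  v.1 < k ->
  (\sum_(q <- partial_gsaws v k.+2 | window k.+1 q == t) 'X^(size q) =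
   \sum_(p <- partial_gsaws v k.+1) 'X^(size p) * transfer v.2 (window k p) t)%R.
Proof.
move=> vk.
pose cut (q : seq (grid_vertex h)) := (upto k.+1 q, window k q).
pose ext (p : seq (grid_vertex h)) := [seq w <- uniq_words h 3 | extends v.2 (window k p) w].
pose L := [seq (p, w) | p <- partial_gsaws v k.+1, w <- ext p].
have cutL : perm_eq [seq cut q | q <- partial_gsaws v k.+2] L.
  apply: uniq_perm.
  - rewrite map_inj_in_uniq ?uniq_partial_gsaws // => p q.
    rewrite !mem_partial_gsaws => /and4P[_ _ pP _] /and4P[_ _ qP _] [].
    exact: restrictions_inj pP qP.
  - apply: allpairs_uniq_dep; first exact: uniq_partial_gsaws.
      by move=> p _; rewrite filter_uniq ?uniq_uniq_words.
    by move=> [p w] [p' w'] _ _ /= [-> ->].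
  move=> [p w]; apply/mapP/allpairsPdep => [[q]|[p' [w' []]]].
    rewrite mem_partial_gsaws => qP [-> ->]; exists (upto k.+1 q), (window k q).
    have [pP extq] := partial_gsaw_restrict vk qP; split=> //.
      by rewrite mem_partial_gsaws.
    case/and4P: qP => /= /andP[_ uq] qk _ _.
    by rewrite mem_filter extq window_uniq_words // addn3.
  rewrite mem_partial_gsaws mem_filter mem_uniq_words => pP /and3P[extw uw w3] [-> ->].
  have [q [qP qp qw]] := partial_gsaw_extend vk pP uw w3 extw.
  by exists q; rewrite ?mem_partial_gsaws // /cut qp qw.
pose wt (pw : seq (grid_vertex h) * seq (grid_vertex h)) : {poly rat} :=
  ('X^(size pw.1 + count (fun u => u.1 == 2) pw.2))%R.
transitivity (\sum_(pw <- L | window 1 pw.2 == t) wt pw)%R; last first.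
  rewrite big_mkcond big_allpairs_dep /=; apply: eq_bigr => p _.
  rewrite big_filter /transfer mulr_sumr [RHS]big_mkcond [LHS]big_mkcond /=.
  apply: eq_bigr => w _; case: (extends _ _ _) => //=.
  by case: ifP => // _; rewrite -exprD.
rewrite -(perm_big _ cutL) big_map big_seq_cond [RHS]big_seq_cond /=.
apply: eq_big => [q|q /andP[]]; first by rewrite window_window addn1.
rewrite mem_partial_gsaws => /and4P[_ qk _ _] _; congr ('X^_)%R.
rewrite -(count_predC (fun u : grid_vertex h => u.1 <= k.+1)) /wt /= size_filter.
congr (_ + _); rewrite count_map count_filter; apply: eq_in_count => u /(allP qk) /= uk.
rewrite -ltnNge; apply/idP/andP => [ku|[/eqP /= E ku]].
  have E : u.1 = k.+2 by apply/eqP; rewrite eqn_leq uk.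
  by rewrite E -addn2 addKn leq_addr.
by rewrite -(subnK ku) E add2n.
Qed.

(** * Recovering the GSAWs from the partial walks *)

Lemma displacement_leq (h m : nat) (v : grid_vertex h) (p : seq (grid_vertex h)) :
  v.1 = 0 -> (displacement v p <= m) = all (fun u => u.1 <= m) p.
Proof.
move=> v0; rewrite /displacement [X in _ - X]big_cons v0 min0n subn0.
apply/bigmax_leqP_seq/allP => [H u up|H u]; first by apply: H; rewrite // inE up orbT.
by rewrite inE => /predU1P[->|/H//]; rewrite v0.
Qed.

Definition gsaws (h : nat) (v : grid_vertex h) (m : nat) : seq (seq (grid_vertex h)) :=
  [seq p <- uniq_words h m.+1 | `[< gsaw (@grid_edge h) v p >] && (displacement v p == m)].

Lemma mem_gsaws (h m : nat) (v : grid_vertex h) (p : seq (grid_vertex h)) :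
  v.1 = 0 ->
  (p \in gsaws v m) = `[< gsaw (@grid_edge h) v p >] && (displacement v p == m).
Proof.
move=> v0; rewrite mem_filter mem_uniq_words andb_idr // => /andP[].
move=> /asboolP[_ /= /andP[_ ->] _] /eqP dm.
by have := displacement_leq m p v0; rewrite dm leqnn => <-.
Qed.

Lemma gsaw_gfE (h i j : nat) (v : grid_vertex h) :
  v.1 = 0 -> gsaw_gf v i j = ((\sum_(p <- gsaws v j) 'X^(size p))`_i)%R.
Proof.
move=> v0; rewrite /gsaw_gf; have -> : fset_set (gsaw_class v i j) =
    [fset p in [seq p <- gsaws v j | size p == i]]%fset.
  apply/fsetP => p; rewrite in_fset_set ?in_fset /=; last exact: finite_gsaw_class.
  rewrite mem_filter mem_gsaws //; apply/asboolP/and3P => [[g <- <-]|[]].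
    by split=> //; apply/asboolP.
  by move=> /eqP si /asboolP g /eqP dj; split.
rewrite card_fseq undup_id ?filter_uniq ?undup_uniq //.
rewrite size_filter -sum1_count natr_sum big_mkcond /= coef_sum.
by apply: eq_bigr => p _; rewrite coefXn eq_sym; case: eqP.
Qed.

(** The accepting states: the walk reaches the first column of the window but not the second, so its
    displacement is known. *)
Definition left_column (h : nat) (w : seq (grid_vertex h)) : bool :=
  (w != [::]) && all (fun u => u.1 == 0) w.

(** If column [m.+2] is empty, no jump inside it occurs and the trapping condition is in force, so
    the partial walk is a genuine GSAW. *)
Lemma perm_gsaws (h m : nat) (v : grid_vertex h) :
  v.1 = 0 ->
  perm_eq (gsaws v m.+1)
    [seq p <- partial_gsaws v m.+2 | left_column (window m.+1 p)].
Proof.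
move=> v0; apply: uniq_perm; rewrite ?filter_uniq ?undup_uniq //.
move=> p; rewrite mem_gsaws // mem_filter mem_partial_gsaws.
rewrite eqn_leq displacement_leq // ltnNge displacement_leq //.
have lc : all (fun u => u.1 <= m.+2) p ->
    left_column (window m.+1 p) = ~~ all (fun u => u.1 <= m) p && all (fun u => u.1 <= m.+1) p.
  move=> pm2; congr (_ && _).
    rewrite -has_predC -size_eq0 size_map size_filter -lt0n -has_count.
    by apply: eq_has => u /=; rewrite ltnNge.
  rewrite all_map all_filter; apply: eq_in_all => u /(allP pm2) /= um2.
  apply/implyP/idP => [H|um1 mu]; last by rewrite subn_eq0.
  by case: (leqP u.1 m.+1) => // um1; move: (H (ltnW um1)); rewrite subn_eq0 leqNgt um1.
apply/idP/idP.
  case/andP=> /asboolP[vp up tr] /andP[pm npm].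
  have pm2 : all (fun u => u.1 <= m.+2) p by apply: sub_all pm => u /leqW.
  rewrite lc // npm pm /=; apply/and4P; split=> //.
    by apply: sub_path vp => a b ab; rewrite /frontier_edge ab.
  by apply/implyP => _; apply/asboolP.
case/andP=> + pP; have /and4P[up pm2 vp ptr] := pP; rewrite lc // => /andP[npm pm].
have vpm : all (fun u => u.1 <= m.+1) (v :: p) by rewrite /= v0.
rewrite npm pm !andbT; apply/asboolP; split=> //.
  apply: sub_in_path vpm vp => a b am bm /orP[//|/andP[/eqP E _]].
  by move: am; rewrite unfold_in E ltnn.
have /asboolP := implyP ptr (allP vpm _ (mem_last v p)); exact.
Qed.

Theorem theorem4p1 (h : nat) (h_ge1 : (1 <= h)%N) :
  fps2_rational (gsaw_gf (top_left h_ge1)).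
Proof.
set v := top_left h_ge1; have v0 : v.1 = 0 by [].
pose F m : {poly rat} := (\sum_(p <- gsaws v m) 'X^(size p))%R.
(* The state at stage [n] sits on columns [n.+1], [n.+2], so the start in column 0 is always to its
   left. *)
have [||n p|n t _|c c_neq0 cF] := @transfer_recurrence {poly rat} _ _ (uniq_words h 2)
  (fun n => partial_gsaws v n.+2) (fun n => @window h n.+1)
  (fun p => 'X^(size p)%R) (transfer v.2) (@left_column h) [::].
- exact: mem_uniq_words.
- exact: uniq_uniq_words.
- rewrite mem_partial_gsaws => /and4P[/= /andP[_ up] pk _ _].
  by rewrite window_uniq_words // addn2.
- exact: partial_gsaws_transfer.
have -> : gsaw_gf v = (fun i j => (F j)`_i)%R.
  by apply/funext => i; apply/funext => j; exact: gsaw_gfE.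
(* The recurrence given by [c] concerns [F] from index 1 on; the factor ['X] absorbs this shift. *)
apply: (@fps2_rational_recurrence _ F ('X * c)%R) => [|n].
  by rewrite mulf_neq0 ?polyX_eq0.
rewrite mulrC size_mulX // big_ord_recl coefMX mul0r add0r -[RHS](cF n).
apply: eq_bigr => k _; rewrite coefMX /=; congr (_ * _)%R.
by rewrite /F addnS (perm_big _ (perm_gsaws _ v0)) big_filter.
Qed.
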